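(* Let $k\ge 2$. For every oriented word $u$ of rank $k$, $$P_{u^{-1}}=(P_u)^{R},$$ where $(P_u)^R=\{g^R\mid g\in P_u\}$ is the set of word reversals of the elements of $P_u$.
   Context: Let $k\ge 2$ and let $\mathcal{A}=\{a_1,\dots,a_k\}$ be a basis of the free group $F_k$. For $a\in\mathcal{A}$ the inverse is denoted by the corresponding uppercase letter ($A=a^{-1}$, $B=b^{-1}$, $A_i=a_i^{-1}$). Letters in $\mathcal{A}$ are called positive (lowercase), letters in $\mathcal{A}^{-1}$ negative (uppercase), and $\mathcal{A}^{\pm}=\mathcal{A}\cup\mathcal{A}^{-1}$. Elements of $F_k$ are identified with reduced group words over $\mathcal{A}^\pm$; $e$ is the trivial element. An oriented word of rank $k$ is a word of length $2k$ over $\mathcal{A}^\pm$ containing each letter of $\mathcal{A}^\pm$ exactly once. For distinct $x,y\in\mathcal{A}^\pm$, ''$x..y$ in $u$'' means that $x$ is to the left of $y$ in $u$. $\#_w(g)$ is the number of (possibly overlapping) occurrences of $w$ as a contiguous subword of $g$. For an oriented word $u$ of rank $k$ and a reduced word $g$, define $$\alpha_u(g)=\sum_{a,b\in\mathcal{A},\ A..B\text{ in }u}\#_{aB}(g)-\sum_{a,b\in\mathcal{A},\ a..b\text{ in }u}\#_{Ba}(g),$$ $$\beta_u(g)=\sum_{a,b\in\mathcal{A},\ A..b\text{ in }u}\#_{ab}(g)-\sum_{a,b\in\mathcal{A},\ A..b\text{ in }u}\#_{BA}(g)$$ (sums over ordered pairs $(a,b)$; in $\beta_u$ the case $a=b$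 is allowed), and let $\omega(g)=\frac12$ if the last letter of $g$ is in $\mathcal{A}$, $\omega(g)=-\frac12$ if it is in $\mathcal{A}^{-1}$, $\omega(e)=0$. The weight induced by $u$ is $\tau_u=\alpha_u+\beta_u+\omega$ (always evaluated on reduced forms), and $P_u=\{g\in F_k\mid\tau_u(g)>0\}$. For a group word $g=x_1x_2\cdots x_n$, $g^R=x_n\cdots x_2x_1$ is its reversal and $g^{-1}=x_n^{-1}\cdots x_1^{-1}$ its inverse word. In particular, for an oriented word $u$, the word $u^{-1}$ (not freely reduced) is again an oriented word. *)

(* Defs.v *)
From HB Require Import structures.
From mathcomp Require Import all_boot all_order all_algebra.
From mathcomp Require Import classical_sets.

Set Implicit Arguments.
Unset Strict Implicit.
Unset Printing Implicit Defensive.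

Import GRing.Theory Num.Theory.
Local Open Scope ring_scope.

(* The boolean is true for the uppercase (inverse) letter. *)
Definition letter (k : nat) : Type := ('I_k * bool)%type.
HB.instance Definition _ (k : nat) := Finite.on (letter k).

Definition lower (k : nat) (a : 'I_k) : letter k := (a, false).
Definition upper (k : nat) (a : 'I_k) : letter k := (a, true).

Definition is_upper (k : nat) (x : letter k) : bool := x.2.

Definition letter_inv (k : nat) (x : letter k) : letter k := (x.1, ~~ x.2).

(* Group words, not necessarily reduced. *)
Definition word (k : nat) : Type := seq (letter k).

(* No free reduction is performed. *)
Definition word_inv (k : nat) (w : word k) : word k :=
  rev [seq letter_inv x | x <- w].

(* The reduced words are the elements of the free group F_k. *)
Definition reduced (k : nat) (g : word k) : bool :=
  sorted (fun x y : letter k => y != letter_inv x) g.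

Definition oriented_word (k : nat) (u : word k) : Prop :=
  size u = (2 * k)%N /\ forall x : letter k, count_mem x u = 1%N.

(* "x..y in u"; used only when x and y each occur exactly once in u. *)
Definition left_of (k : nat) (u : word k) (x y : letter k) : bool :=
  (index x u < index y u)%N.

(* Occurrences are counted by starting position, so they may overlap. *)
Definition occ (k : nat) (w g : word k) : nat :=
  count (fun i => prefix w (drop i g)) (iota 0 (size g).+1).

Definition alpha (k : nat) (u g : word k) : rat :=
  \sum_(a < k) \sum_(b < k | left_of u (upper a) (upper b))
      (occ [:: lower a; upper b] g)%:R
  - \sum_(a < k) \sum_(b < k | left_of u (lower a) (lower b))
      (occ [:: upper b; lower a] g)%:R.

Definition beta (k : nat) (u g : word k) : rat :=
  \sum_(a < k) \sum_(b < k | left_of u (upper a) (lower b))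
      (occ [:: lower a; lower b] g)%:R
  - \sum_(a < k) \sum_(b < k | left_of u (upper a) (lower b))
      (occ [:: upper b; upper a] g)%:R.

Definition omega (k : nat) (g : word k) : rat :=
  if g is x :: s then (if is_upper (last x s) then - (1 / 2%:R) else 1 / 2%:R)
  else 0.

Definition tau (k : nat) (u g : word k) : rat :=
  alpha u g + beta u g + omega g.

Definition pos_set (k : nat) (u : word k) : set (word k) :=
  [set g | reduced g /\ 0 < tau u g]%classic.

(* Main.v *)
Require Import Defs.
From mathcomp Require Import all_boot all_order all_algebra.
From mathcomp Require Import classical_sets.
From mathcomp Require Import lra.

Set Implicit Arguments.
Unset Strict Implicit.
Unset Printing Implicit Defensive.

Import GRing.Theory Num.Theory.
Local Open Scope ring_scope.

(** The two weights agree: the weight of the reversal of [g] induced by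
    [word_inv u] is the weight of [g] induced by [u].  This gives the theorem,
    since reversal is an involution which preserves reducedness.

    Inverting [u] turns x..y into y^-1..x^-1 ([left_of_word_inv]), and reversing
    [g] turns the occurrences of xy into those of yx ([occ_pair_rev]).  In the
    [beta] part the condition A..b becomes B..a, so the two effects together only
    exchange the summation indices and [beta] is unchanged.  In the [alpha] part
    the two sums trade places and all order conditions are reversed.  A reduced
    word contains neither aA nor Aa, so the change in [alpha] is the number of
    all subwords aB minus the number of all subwords Ba.  The subwords aB are the
    passages from a positive to a negative letter, and the subwords Ba those from
    a negative to a positive one; they alternate along [g], so their difference
    depends only on the signs of the first and the last letter.  It is
    [omega (rev g) - omega g] ([sum_occ_sign_change]), which is what [omega]
    contributes to the difference of the weights. *)

Lemma letter_invK (k : nat) : involutive (@letter_inv k).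
Proof. by case=> i b; rewrite /letter_inv /= negbK. Qed.

Lemma reduced_rev (k : nat) (g : word k) : reduced (rev g) = reduced g.
Proof.
rewrite /reduced rev_sorted; apply: eq_sorted => x y /=.
by rewrite eq_sym (can2_eq (@letter_invK k) (@letter_invK k)).
Qed.

Lemma index_rev (T : eqType) (s : seq T) (x : T) :
  uniq s -> x \in s -> index x (rev s) = (size s - (index x s).+1)%N.
Proof.
move=> us xs; have lt_i : (index x s < size s)%N by rewrite index_mem.
have lt_j : (size s - (index x s).+1 < size s)%N by rewrite subnSK ?leq_subr.
have nth_j : nth x (rev s) (size s - (index x s).+1) = x.
  by rewrite nth_rev // subnSK // subKn ?nth_index // ltnW.
by rewrite -{1}nth_j index_uniq ?size_rev ?rev_uniq.
Qed.

Lemma mem_oriented_word (k : nat) (u : word k) (x : letter k) :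
  oriented_word u -> x \in u.
Proof. by case=> _ cu; rewrite -has_pred1 has_count cu. Qed.

Lemma left_of_word_inv (k : nat) (u : word k) (x y : letter k) :
  oriented_word u ->
  left_of (word_inv u) x y = left_of u (letter_inv y) (letter_inv x).
Proof.
move=> hu; have mem_u z : z \in u := mem_oriented_word z hu.
have us : uniq u by apply: count_mem_uniq => z; rewrite hu.2 mem_u.
have inj := inv_inj (@letter_invK k).
have idx z : index z (word_inv u) = (size u - (index (letter_inv z) u).+1)%N.
  rewrite -{1}(letter_invK z) index_rev ?map_inj_uniq ?map_f //.
  by rewrite size_map index_map.
rewrite /left_of !idx ltn_sub2lE ?index_mem //; exact: mem_u.
Qed.

Lemma occ_pair_cons (k : nat) (x y z : letter k) (g : word k) :
  occ [:: x; y] (z :: g) =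
  ((x == z) && prefix [:: y] g + occ [:: x; y] g)%N.
Proof. by rewrite /occ /= drop0 (iotaDl 1 1) count_map. Qed.

Lemma occ_pair_rcons (k : nat) (x y z t : letter k) (g : word k) :
  occ [:: x; y] (rcons (rcons g z) t) =
  (occ [:: x; y] (rcons g z) + ((x == z) && (y == t)))%N.
Proof.
elim: g => [|c g IHg]; first by rewrite /= !occ_pair_cons /= !andbT !andbF addnC.
by rewrite /= !occ_pair_cons IHg addnA; case: g {IHg} => //= d g; rewrite !prefix0s.
Qed.

Lemma occ_pair_rev (k : nat) (x y : letter k) (g : word k) :
  occ [:: x; y] (rev g) = occ [:: y; x] g.
Proof.
elim: g => // z [|t g] IHg; first by rewrite !occ_pair_cons /= !andbF.
rewrite 2!rev_cons occ_pair_rcons -rev_cons IHg [RHS]occ_pair_cons addnC.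
by rewrite /= prefix0s andbT andbC.
Qed.

Lemma occ_pair_cancel (k : nat) (x : letter k) (g : word k) :
  reduced g -> occ [:: x; letter_inv x] g = 0%N.
Proof.
elim: g => // z g IHg; rewrite occ_pair_cons.
case: g IHg => [|t g] IHg; first by rewrite /= andbF.
rewrite /reduced /= => /andP[ntz red_g]; rewrite IHg // addn0 prefix0s andbT.
by apply/eqP; rewrite eqb0; apply: contra ntz => /andP[/eqP-> /eqP->].
Qed.

(** A letter has exactly one underlying generator, so summing over the
    generators leaves only the condition on its sign. *)
Lemma sum_letter_case (k : nat) (c : bool) (z : letter k) :
  \sum_(a < k) (((a, c) : letter k) == z)%:R = (z.2 == c)%:R :> rat.
Proof.
case: z => i d /=; rewrite (bigD1 i) //= big1 ?addr0 => [|j /negbTE ne].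
  by rewrite xpair_eqE eqxx eq_sym.
by rewrite xpair_eqE ne.
Qed.

Lemma sum_occ_cons (k : nat) (c d : bool) (z t : letter k) (g : word k) :
  \sum_(a < k) \sum_(b < k) (occ [:: (a, c); (b, d)] [:: z, t & g])%:R =
  ((z.2 == c) && (t.2 == d))%:R +
  \sum_(a < k) \sum_(b < k) (occ [:: (a, c); (b, d)] (t :: g))%:R :> rat.
Proof.
rewrite -mulnb natrM -!sum_letter_case mulr_suml -big_split /=.
apply: eq_bigr => a _; rewrite mulr_sumr -big_split /=; apply: eq_bigr => b _.
by rewrite occ_pair_cons natrD -natrM mulnb /= prefix0s andbT.
Qed.

(** Telescoping: a two-letter subword zt changes the sign from z to t, so summed
    along [g] the signed number of sign changes is determined by the two ends.
    The first letter of [g] is the last one of [rev g], which is why [omega]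
    expresses both ends. *)
Lemma sum_occ_sign_change (k : nat) (g : word k) :
  \sum_(a < k) \sum_(b < k) (occ [:: lower a; upper b] g)%:R
  - \sum_(a < k) \sum_(b < k) (occ [:: upper a; lower b] g)%:R
  = omega (rev g) - omega g.
Proof.
have omega_rcons s z : omega (rcons s z) =
    if is_upper z then - (1 / 2%:R) else 1 / 2%:R :> rat.
  by case: s => //= x s; rewrite last_rcons.
elim: g => [|z [|t g] IHg].
- by rewrite !big1 ?subrr // => a _; apply: big1 => b _.
- rewrite subrr !big1 ?subrr // => a _; apply: big1 => b _;
    by rewrite occ_pair_cons /= andbF.
rewrite !sum_occ_cons; move: IHg; rewrite !rev_cons !omega_rcons /is_upper /=.
set X := \sum_(a < k) _; set Y := \sum_(a < k) _.
by case: z.2; case: t.2; case: ifP => _ /=; lra.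
Qed.

(** The positions in [u] order the letters totally, so every pair of distinct
    generators is counted in exactly one of the two restricted sums; the diagonal
    is counted in neither, hence the condition that [F] vanishes there. *)
Lemma sum_left_of (k : nat) (u : word k) (c : bool) (F : 'I_k -> 'I_k -> rat) :
  oriented_word u -> (forall a, F a a = 0) ->
  \sum_(a < k) \sum_(b < k | left_of u (a, c) (b, c)) F a b
  + \sum_(a < k) \sum_(b < k | left_of u (b, c) (a, c)) F a b
  = \sum_(a < k) \sum_(b < k) F a b.
Proof.
move=> hu F0; have mem_u z : z \in u := mem_oriented_word z hu.
rewrite -big_split; apply: eq_bigr => a _ /=.
rewrite big_mkcond [X in _ + X]big_mkcond -big_split; apply: eq_bigr => b _ /=.
rewrite /left_of; case: ltngtP => [||eq_i]; rewrite ?addr0 ?add0r //.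
by case: (index_inj (a, c) (mem_u _) (mem_u _) eq_i) => ->; rewrite F0.
Qed.

Lemma beta_word_inv_rev (k : nat) (u g : word k) :
  oriented_word u -> beta (word_inv u) (rev g) = beta u g.
Proof.
move=> hu; rewrite /beta; congr (_ - _); rewrite (exchange_big_dep xpredT) //=;
  apply: eq_bigr => a _; apply: eq_big => b;
  by rewrite ?left_of_word_inv // occ_pair_rev.
Qed.

Lemma alpha_word_inv_rev (k : nat) (u g : word k) :
  oriented_word u ->
  alpha (word_inv u) (rev g) =
  \sum_(a < k) \sum_(b < k | left_of u (lower b) (lower a))
      (occ [:: upper b; lower a] g)%:R
  - \sum_(a < k) \sum_(b < k | left_of u (upper b) (upper a))
      (occ [:: lower a; upper b] g)%:R.
Proof.
move=> hu; rewrite /alpha; congr (_ - _); apply: eq_bigr => a _;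
  by apply: eq_big => b; rewrite ?left_of_word_inv // occ_pair_rev.
Qed.

(** Splitting each unrestricted sum of [sum_occ_sign_change] by the order of the
    two letters in [u] yields the two sums of [alpha u g] and those of
    [alpha_word_inv_rev]; the diagonal terms vanish because [g] is reduced. *)
Lemma alpha_omega_word_inv_rev (k : nat) (u g : word k) :
  oriented_word u -> reduced g ->
  alpha (word_inv u) (rev g) + omega (rev g) = alpha u g + omega g.
Proof.
move=> hu red_g; have := sum_occ_sign_change g.
(* The second sum of [alpha] has the positive letter as its outer index. *)
rewrite [X in _ - X]exchange_big /=.
rewrite -(sum_left_of true hu) => [|a]; last first.
  by rewrite (occ_pair_cancel (lower a)).
rewrite -(sum_left_of false hu) => [|a]; last first.
  by rewrite (occ_pair_cancel (upper a)).
rewrite alpha_word_inv_rev // /alpha /upper /lower; lra.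
Qed.

Lemma tau_word_inv_rev (k : nat) (u g : word k) :
  oriented_word u -> reduced g -> tau (word_inv u) (rev g) = tau u g.
Proof.
move=> hu red_g; rewrite /tau beta_word_inv_rev // addrAC.
by rewrite alpha_omega_word_inv_rev // addrAC.
Qed.

Theorem theorem3 (k : nat) (hk : (2 <= k)%N) (u : word k)
    (hu : oriented_word u) :
  pos_set (word_inv u) = [set rev g | g in pos_set u]%classic.
Proof.
apply/seteqP; split=> [g [red_g tau_g]|_ [g [red_g tau_g] <-]].
  exists (rev g); last exact: revK.
  by split; rewrite ?reduced_rev // -tau_word_inv_rev ?revK ?reduced_rev.
by split; rewrite ?reduced_rev ?tau_word_inv_rev.
Qed.
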